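(* Let a system of polynomials $Q=\{Q_0(x),\dots,Q_{n-1}(x)\}$, $\deg Q_k=k$, be defined by recurrence relations of one of the following three forms: (i) (quasiseparable) $\begin{bmatrix}G_k(x)\\Q_k(x)\end{bmatrix}=\begin{bmatrix}\alpha_k&\beta_k\\ \gamma_k&\delta_kx+\theta_k\end{bmatrix}\begin{bmatrix}G_{k-1}(x)\\Q_{k-1}(x)\end{bmatrix}$; (ii) (semiseparable) $\begin{bmatrix}G_k(x)\\Q_k(x)\end{bmatrix}=\begin{bmatrix}\alpha_k&\beta_k\\ \gamma_k&1\end{bmatrix}\begin{bmatrix}G_{k-1}(x)\\(\delta_kx+\theta_k)Q_{k-1}(x)\end{bmatrix}$; (iii) (well-free) $Q_k(x)=(\alpha_kx-\delta_k)Q_{k-1}(x)-(\beta_kx+\gamma_k)Q_{k-2}(x)$, where for $k=1$ the last term is absent. Let $G\in\mathbb{C}^{n\times\alpha}$, $B\in\mathbb{C}^{\alpha\times n}$ be arbitrary matrices and let $x_1,\dots,x_n$ be arbitrary nonzero numbers. Let $R\in\mathbb{C}^{n\times n}$ be defined by the displacement equation $$D_{\frac1x}\,R-R\,W_Q=G\,B.$$ Then the complexity of computing all elements of $R^{-1}$ is no more than $\mathcal{O}(\alpha n^2)$ operations.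
   Context: The recurrences hold for $k=1,\dots,n-1$; the $G_k(x)$ in (i) and (ii) are auxiliary polynomials (not to be confused with the matrix $G$). The input consists of the recurrence relations, the matrices $G$, $B$ and the numbers $x_1,\dots,x_n$. $D_{\frac1x}=\mathrm{diag}(1/x_1,\dots,1/x_n)$. Writing the system as $Q_0(x)=\tau_0$, $Q_k(x)=\tau_kx\,Q_{k-1}(x)-\sum_{j=0}^{k-1}a_{j,k}Q_j(x)$ for $k=1,\dots,n-1$, the $n\times n$ matrix $M_Q$ is unit upper triangular with $(j+1,k+1)$ entry $a_{j,k}$ for $0\le j<k\le n-1$, the $n\times n$ matrix $N_Q$ has $(k,k+1)$ entry $\tau_k$ for $k=1,\dots,n-1$ and zeros elsewhere, and $W_Q=N_QM_Q^{-1}$. *)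

(* Defs.v *)
From HB Require Import structures.
From mathcomp Require Import all_boot all_order all_algebra.
From mathcomp Require Export complex.
From mathcomp Require Export reals.

Set Implicit Arguments.
Unset Strict Implicit.
Unset Printing Implicit Defensive.

Import GRing.Theory.
Local Open Scope ring_scope.

(** * Algebraic computation trees

    The complexity of a problem is the number of operations executed, for the
    worst valid input, by an algebraic computation tree solving it.  A tree
    receives its input in variables; [V] is the type of the variables in scope
    and an instruction makes one new variable, [None : option V], available to
    the rest of the tree.  The operations are the four arithmetic operations,
    the constants 0 and 1, and branching on whether a value is zero; each of
    them costs 1.  A tree refers to no particular field. *)

Inductive instr (V : Type) : Type :=
| Zero
| One
| Add of V & V
| Sub of V & V
| Mul of V & V
| Div of V & V.

Inductive comp_tree (O V : Type) : Type :=
| Return of (O -> V)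
| Compute of instr V & comp_tree O (option V)
| IfZero of V & comp_tree O V & comp_tree O V.

(* Division by zero is undefined, contrary to the MathComp convention. *)
Definition exec (F : fieldType) (V : Type) (e : V -> F) (c : instr V) :
    option F :=
  match c with
  | Zero => Some 0
  | One => Some 1
  | Add u v => Some (e u + e v)
  | Sub u v => Some (e u - e v)
  | Mul u v => Some (e u * e v)
  | Div u v => if e v == 0 then None else Some (e u / e v)
  end.

(* [run t e] is [Some (out, k)] if [t], started on the input [e], produces the
   output [out] after [k] operations, and [None] if it divides by zero. *)
Fixpoint run (F : fieldType) (O V : Type) (t : comp_tree O V) :
    (V -> F) -> option ((O -> F) * nat) :=
  match t with
  | Return o => fun e => Some (fun i => e (o i), 0%N)
  | Compute c t' => fun e =>
      if exec e c is Some z then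
        if run t' (oapp e z) is Some (out, k) then Some (out, k.+1) else None
      else None
  | IfZero v t0 t1 => fun e =>
      if (if e v == 0 then run t0 e else run t1 e) is Some (out, k)
      then Some (out, k.+1) else None
  end.

(** * Polynomial systems given by recurrence relations *)

Inductive recurrence_form : Type := Quasiseparable | Semiseparable | WellFree.

(* The coefficients at index k belong to the k-th step of the recurrence, for
   0 < k < n; [initQ] and [initG] are the constants Q_0 and G_0.  [theta] and
   [initG] play no role in the well-free form. *)
Record recurrence (F : Type) : Type := Recurrence {
  alpha : nat -> F;
  beta : nat -> F;
  gamma : nat -> F;
  delta : nat -> F;
  theta : nat -> F;
  initQ : F;
  initG : F }.

Section PolynomialSystems.
Variable F : fieldType.
Implicit Types (r : recurrence F) (Q : nat -> {poly F}) (n : nat).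

Definition quasiseparable_system r n Q : Prop :=
  exists G : nat -> {poly F},
    G 0%N = (initG r)%:P /\
    forall k, (0 < k < n)%N ->
      G k = alpha r k *: G k.-1 + beta r k *: Q k.-1 /\
      Q k = gamma r k *: G k.-1 + (delta r k *: 'X + (theta r k)%:P) * Q k.-1.

Definition semiseparable_system r n Q : Prop :=
  exists G : nat -> {poly F},
    G 0%N = (initG r)%:P /\
    forall k, (0 < k < n)%N ->
      let S := (delta r k *: 'X + (theta r k)%:P) * Q k.-1 in
      G k = alpha r k *: G k.-1 + beta r k *: S /\
      Q k = gamma r k *: G k.-1 + S.

Definition well_free_system r n Q : Prop :=
  forall k, (0 < k < n)%N ->
    Q k = (alpha r k *: 'X - (delta r k)%:P) * Q k.-1
          - (if k == 1%N then 0
             else (beta r k *: 'X + (gamma r k)%:P) * Q k.-2).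

Definition defines_system (f : recurrence_form) r n Q : Prop :=
  Q 0%N = (initQ r)%:P /\
  match f with
  | Quasiseparable => quasiseparable_system r n Q
  | Semiseparable => semiseparable_system r n Q
  | WellFree => well_free_system r n Q
  end.

(* When [size (Q k) = k.+1] for all k < n, these relations determine [tau k]
   for k < n and [a j k] for j < k < n. *)
Definition full_recurrence n Q (tau : nat -> F) (a : nat -> nat -> F) : Prop :=
  Q 0%N = (tau 0%N)%:P /\
  forall k, (0 < k < n)%N ->
    Q k = tau k *: ('X * Q k.-1) - \sum_(j < k) a j k *: Q j.

(* Row and column indices start at 0: [MQ] has the entry [a j k] at (j, k), and
   [NQ] has the entry [tau k] at (k - 1, k). *)
Definition MQ n (a : nat -> nat -> F) : 'M[F]_n :=
  \matrix_(j, k) (if j == k then 1 else if (j < k)%N then a j k else 0).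

Definition NQ n (tau : nat -> F) : 'M[F]_n :=
  \matrix_(j, k) (if k == j.+1 :> nat then tau k else 0).

Definition WQ n (tau : nat -> F) (a : nat -> nat -> F) : 'M[F]_n :=
  NQ n tau *m invmx (MQ n a).

Definition Dinv n (x : 'I_n -> F) : 'M[F]_n := diag_mx (\row_i (x i)^-1).

End PolynomialSystems.

(* The names of the data available to an algorithm for given [n] and displacement
   rank [p]; the coefficient named by i : 'I_n.-1 is that of step i + 1. *)
Inductive input (n p : nat) : Type :=
| InAlpha of 'I_n.-1
| InBeta of 'I_n.-1
| InGamma of 'I_n.-1
| InDelta of 'I_n.-1
| InTheta of 'I_n.-1
| InInitQ
| InInitG
| InG of 'I_n & 'I_p
| InB of 'I_p & 'I_n
| InX of 'I_n.

Definition input_value (F : fieldType) (n p : nat) (r : recurrence F)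
    (G : 'M[F]_(n, p)) (B : 'M[F]_(p, n)) (x : 'I_n -> F)
    (v : input n p) : F :=
  match v with
  | InAlpha k => alpha r k.+1
  | InBeta k => beta r k.+1
  | InGamma k => gamma r k.+1
  | InDelta k => delta r k.+1
  | InTheta k => theta r k.+1
  | InInitQ => initQ r
  | InInitG => initG r
  | InG i j => G i j
  | InB i j => B i j
  | InX i => x i
  end.

(* Main.v *)
From mathcomp Require Import all_boot all_order all_algebra.
From mathcomp Require Import boolp classical_sets.
From mathcomp Require Import ring zify.
From mathcomp Require Import reals complex.
Require Import Defs.

(** Write [W] for the matrix [W_Q], [X] for [R^-1 G] and [Y] for [B R^-1].  The
    inverse satisfies [R^-1 D - W R^-1 = X Y], so its columns come from [X] and
    [Y] by solving systems with the matrices [1/x - W], and [X] and [Y] come from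
    an elimination on [R] that only stores [G] and [B].  Three facts carry this.

    First, [W] is multiplied with vectors in linear time.  Given a row vector
    [v], let [h = v W] and let [l] be the linear functional on polynomials with
    [l (Q_j) = h_j].  The definition of [W] says that [h_0 = 0] and
    [l (x Q_(k-1)) = v_(k-1)], so that applying [l] to any of the three kinds of
    recurrence relations gives, without a division, a recursion for [h] with a
    state of dimension two ([WQ_realizes]).  The recursion is causal: [h_k] only
    depends on [v_j] for [j < k].  Hence [v = x (v W + g)] is solved by running
    it ([derives_response]), and [y = x (t + W y)] by running the adjoint
    recursion backwards ([response_adjoint], [derives_coresponse]).

    Second, Gaussian elimination respects the displacement equation
    ([reduced_step]).  Subtracting from [R] the rank-one matrix made of a pivot's
    column and row changes [G] and [B] by rank-one matrices too, since [D] is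
    diagonal and [W] strictly upper triangular.  The matrices keep their size, the
    eliminated rows and columns being zero from then on, so pivoting needs no
    permutation.  A step costs O(p n): the pivot column is [x_i (G B)_(i,m)], as
    the earlier columns have been eliminated, and the pivot row solves a system
    with [1/x_i - W].

    Third, the equations [R X = G] and [Y R = B] survive each step with the same
    [X] and [Y].  So the step with the pivot in row [i] and column [m] expresses
    row [m] of [X] and column [i] of [Y] by those belonging to later steps, and
    back substitution finds them all in O(p n^2) operations
    ([derives_generators], [derives_inverse]).

    When [p = 0], the first column of [R] would vanish, so no instance exists. *)

Set Implicit Arguments.
Unset Strict Implicit.
Unset Printing Implicit Defensive.

Import GRing.Theory.
Local Open Scope classical_set_scope.
Local Open Scope ring_scope.

(** * Quantities obtainable by computation trees *)

Section Derivability.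
Variables (F : fieldType) (E : Type).
Implicit Types (P : set E) (S T : set (E -> F)) (q a b : E -> F) (c d : nat).

(** The intermediate results of an algorithm are treated as functions [E -> F] on
    a type [E] of problem instances, and [P] is the set of instances that can
    still occur on the current branch of the tree. *)
Definition available P V (K : E -> V -> F) S : Prop :=
  forall q, S q -> exists v, forall e, P e -> K e v = q e.

Definition solvable O (tgt : E -> O -> F) P S c : Prop :=
  forall (V : Type) (K : E -> V -> F), available P K S ->
  exists t : comp_tree O V, forall e, P e ->
    exists out k, [/\ run t (K e) = Some (out, k), (k <= c)%N
                    & forall o, out o = tgt e o].

(** From the values in [S] those in [T] are obtained in [c] operations.  Phrased
    by what may follow, so that composing computations is composing
    implications and no substitution in trees is needed; after a branching, the
    rest of the computation is attached to both branches.  The quantification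
    over [P'] and [S'] makes the notion monotone, and [P1] is there because the
    rest may be attached on a branch where fewer instances are possible. *)
Definition derives P S T c : Prop :=
  forall P' S' O (tgt : E -> O -> F) d, P' `<=` P -> S `<=` S' ->
    (forall P1, P1 `<=` P' -> solvable tgt P1 (S' `|` T) d) ->
    solvable tgt P' S' (c + d).

Lemma solvable_return O (tgt : E -> O -> F) P S :
  (forall o, S (tgt^~ o)) -> solvable tgt P S 0.
Proof.
move=> St V K av.
have [f fE] := choice (fun o => av _ (St o)).
by exists (Return f) => e Pe; exists (fun o => K e (f o)), 0%N; split => // o; exact: fE.
Qed.

Lemma solvable_mono O (tgt : E -> O -> F) P S S' c c' :
  S `<=` S' -> (c <= c')%N -> solvable tgt P S c -> solvable tgt P S' c'.
Proof.
move=> sS cc sol V K av.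
have [t tE] := sol V K (fun q Sq => av q (sS q Sq)).
exists t => e /tE[out [k [rE kc oE]]]; exists out, k; split=> //.
exact: leq_trans cc.
Qed.

Lemma derives_mono P P' S S' T T' c c' :
  P' `<=` P -> S `<=` S' -> T' `<=` S' `|` T -> (c <= c')%N ->
  derives P S T c -> derives P' S' T' c'.
Proof.
move=> sP sS sT cc dv P1 S1 O tgt d sP1 sS1 sol.
apply: (@solvable_mono _ _ _ S1 _ (c + d)) => //; first by rewrite leq_add2r.
apply: dv; [exact: subset_trans sP | exact: subset_trans sS1 |].
move=> P2 sP2; apply: solvable_mono (sol _ sP2) => //.
by move=> q [S1q | /sT[/sS1 S1q|Tq]]; [left | left | right].
Qed.

Lemma derives_le P S T c c' : derives P S T c -> (c <= c')%N -> derives P S T c'.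
Proof. by move=> dT cc; apply: derives_mono dT. Qed.

Lemma derives_refl P S T : T `<=` S -> derives P S T 0.
Proof.
move=> sT P' S' O tgt d _ sS sol; apply: solvable_mono (sol P' _) => //.
by move=> q [//|/sT/sS].
Qed.

Lemma derives_trans P S T1 T2 c1 c2 :
  derives P S T1 c1 -> derives P (S `|` T1) T2 c2 ->
  derives P S (T1 `|` T2) (c1 + c2).
Proof.
move=> d1 d2 P' S' O tgt d sP sS sol; rewrite -addnA; apply: d1 => // P1 sP1.
apply: d2 => [||P2 sP2]; first exact: subset_trans sP.
  by move=> q [/sS|]; [left | right].
by rewrite -setUA; apply: sol; apply: subset_trans sP1.
Qed.

Lemma derives_cut c1 c2 P S T1 T c :
  derives P S T1 c1 -> derives P (S `|` T1) T c2 -> (c1 + c2 <= c)%N ->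
  derives P S T c.
Proof.
by move=> d1 d2 cc; apply: derives_mono (derives_trans d1 d2) => // q Tq; right; right.
Qed.

Lemma derives_setU P S T1 T2 c1 c2 :
  derives P S T1 c1 -> derives P S T2 c2 -> derives P S (T1 `|` T2) (c1 + c2).
Proof. by move=> d1 d2; apply: derives_trans d1 _; apply: derives_mono d2. Qed.

(** An algorithm may use any expression that has the right value on the instances
    at hand; later lemmas use this to replace a ghost quantity, such as an entry
    of an inverse, by a formula for it. *)
Lemma derives_eq P S q q' c :
  (forall e, P e -> q e = q' e) -> derives P S [set q] c -> derives P S [set q'] c.
Proof.
move=> qE dq P' S' O tgt d sP sS sol; apply: dq => // P1 sP1 V K av.
apply: (sol P1 sP1) => q1 [S'q1|->]; first by apply: av; left.
have [v vE] := av q (or_intror erefl).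
by exists v => e P1e; rewrite vE // qE //; apply/sP/sP1.
Qed.

Lemma derives_instr P S q :
  (forall P' V (K : E -> V -> F), P' `<=` P -> available P' K S ->
     exists i, forall e, P' e -> exec (K e) i = Some (q e)) ->
  derives P S [set q] 1.
Proof.
move=> iP P' S' O tgt d sP sS sol V K av.
have [i iE] := iP P' V K sP (fun q Sq => av q (sS q Sq)).
have [||t tE] := sol P' _ (option V) (fun e => oapp (K e) (q e)) => //.
  move=> q' [/av[v vE]|->]; first by exists (Some v).
  by exists None.
exists (Compute i t) => e P'e /=; rewrite iE //.
have [out [k [-> kd outE]]] := tE e P'e.
by exists out, k.+1.
Qed.

Lemma derives_ifzero P S T q c : S q ->
  derives (P `&` [set e | q e = 0]) S T c ->
  derives (P `&` [set e | q e != 0]) S T c ->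
  derives P S T c.+1.
Proof.
move=> Sq d0 d1 P' S' O tgt d sP sS sol V K av.
have [v vE] := av q (sS q Sq).
have avI (Q : set E) : available (P' `&` Q) K S'.
  by move=> q' /av[w wE]; exists w => e [/wE].
have [||t0 t0E] := d0 (P' `&` [set e | q e = 0]) S' O tgt d _ sS _ V K (avI _).
- by move=> e [/sP].
- by move=> P1 sP1; apply: sol => e /sP1[].
have [||t1 t1E] := d1 (P' `&` [set e | q e != 0]) S' O tgt d _ sS _ V K (avI _).
- by move=> e [/sP].
- by move=> P1 sP1; apply: sol => e /sP1[].
exists (IfZero v t0 t1) => e P'e /=; rewrite vE //.
have [q0|q1] := eqVneq (q e) 0.
  have [out [k [-> kd outE]]] := t0E e (conj P'e q0).
  by exists out, k.+1; split => //; rewrite addSn ltnS.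
have [out [k [-> kd outE]]] := t1E e (conj P'e q1).
by exists out, k.+1; split => //; rewrite addSn ltnS.
Qed.

Lemma derives_zero P S : derives P S [set fun=> 0] 1.
Proof. by apply: derives_instr => P' V K _ _; exists (@Zero V). Qed.

Lemma derives_one P S : derives P S [set fun=> 1] 1.
Proof. by apply: derives_instr => P' V K _ _; exists (@One V). Qed.

Lemma derives_known P S q : S q -> derives P S [set q] 0.
Proof. by move=> Sq; apply: derives_refl => _ ->. Qed.

Lemma derives_binary (op : (E -> F) -> (E -> F) -> E -> F) P S a b c1 c2 :
  (forall P' V (K : E -> V -> F) u v, P' `<=` P ->
     (forall e, P' e -> K e u = a e) -> (forall e, P' e -> K e v = b e) ->
     exists i, forall e, P' e -> exec (K e) i = Some (op a b e)) ->
  derives P S [set a] c1 -> derives P S [set b] c2 ->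
  derives P S [set op a b] (c1 + c2).+1.
Proof.
move=> iP da db; rewrite -addnS; apply: (derives_cut da _ (leqnn _)).
apply: (@derives_cut c2 1 _ _ [set b]); last by rewrite addn1.
  by apply: derives_mono db.
apply: derives_instr => P' V K sP av.
have [u uE] := av a (or_introl (or_intror erefl)).
have [v vE] := av b (or_intror erefl).
exact: iP uE vE.
Qed.

Lemma derives_add P S a b c1 c2 :
  derives P S [set a] c1 -> derives P S [set b] c2 ->
  derives P S [set fun e => a e + b e] (c1 + c2).+1.
Proof.
apply: (@derives_binary (fun a b e => a e + b e)) => P' V K u v _ uE vE.
by exists (Add u v) => e P'e /=; rewrite uE ?vE.
Qed.

Lemma derives_sub P S a b c1 c2 :
  derives P S [set a] c1 -> derives P S [set b] c2 ->
  derives P S [set fun e => a e - b e] (c1 + c2).+1.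
Proof.
apply: (@derives_binary (fun a b e => a e - b e)) => P' V K u v _ uE vE.
by exists (Defs.Sub u v) => e P'e /=; rewrite uE ?vE.
Qed.

Lemma derives_mul P S a b c1 c2 :
  derives P S [set a] c1 -> derives P S [set b] c2 ->
  derives P S [set fun e => a e * b e] (c1 + c2).+1.
Proof.
apply: (@derives_binary (fun a b e => a e * b e)) => P' V K u v _ uE vE.
by exists (Mul u v) => e P'e /=; rewrite uE ?vE.
Qed.

Lemma derives_div P S a b c1 c2 : (forall e, P e -> b e != 0) ->
  derives P S [set a] c1 -> derives P S [set b] c2 ->
  derives P S [set fun e => a e / b e] (c1 + c2).+1.
Proof.
move=> b0; apply: (@derives_binary (fun a b e => a e / b e)) => P' V K u v sP uE vE.
by exists (Div u v) => e P'e /=; rewrite uE ?vE // (negPf (b0 e (sP e P'e))).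
Qed.

Lemma derives_sum P S (I : Type) (s : seq I) (Q : pred I) (f : I -> E -> F) c :
  (forall i, Q i -> derives P S [set f i] c) ->
  derives P S [set fun e => \sum_(i <- s | Q i) f i e] (size s * c.+1).+1.
Proof.
move=> df; elim: s => [|i s IH].
  apply: (@derives_eq _ _ (fun=> 0)) => [e _|]; first by rewrite big_nil.
  exact: derives_zero.
have [Qi|Qi] := boolP (Q i).
  apply: (@derives_eq _ _ (fun e => f i e + \sum_(j <- s | Q j) f j e)).
    by move=> e _; rewrite big_cons Qi.
  by rewrite /= mulSn addSn -addnS; apply: derives_add (df i Qi) IH.
apply: (@derives_eq _ _ (fun e => \sum_(j <- s | Q j) f j e)).
  by move=> e _; rewrite big_cons (negPf Qi).
by apply: derives_mono IH; rewrite ?ltnS ?leq_mul2r ?leqnSn ?orbT.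
Qed.

Lemma derives_seq P S (I : eqType) (s : seq I) (T : I -> set (E -> F)) c :
  (forall i, i \in s -> derives P S (T i) c) ->
  derives P S (\bigcup_(i in [set` s]) T i) (size s * c).
Proof.
elim: s => [|i s IH] dT; first by apply: derives_refl => q [].
have di := dT i (mem_head _ _).
have ds : derives P S (\bigcup_(i in [set` s]) T i) (size s * c).
  by apply: IH => j js; apply: dT; rewrite in_cons js orbT.
apply: derives_mono (derives_setU di ds) => // q [j]; rewrite /= in_cons => /orP[/eqP->|js] Tq; right.
  by left.
by right; exists j.
Qed.

Lemma derives_family P S (I : finType) (T : I -> set (E -> F)) c :
  (forall i, derives P S (T i) c) -> derives P S (\bigcup_i T i) (#|I| * c).
Proof.
move=> dT; rewrite cardE.
apply: derives_mono (derives_seq (fun i (_ : i \in enum I) => dT i)) => //.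
by move=> q [i _ Tq]; right; exists i => //=; rewrite mem_enum.
Qed.

(** For recursions, where step [k] has access to the results of earlier steps. *)
Lemma derives_iter P S (T : nat -> set (E -> F)) N c :
  (forall k, (k < N)%N -> derives P (S `|` \bigcup_(j in `I_k) T j) (T k) c) ->
  derives P S (\bigcup_(j in `I_N) T j) (N * c).
Proof.
elim: N => [|N IH] dT; first by apply: derives_refl => q [].
have dN := derives_trans (IH (fun k kN => dT k (leqW kN))) (dT N (ltnSn N)).
rewrite mulSnr; apply: derives_mono dN => // q [k]; rewrite /= ltnS leq_eqVlt.
by move=> /orP[/eqP->|kN] Tq; right; [right | left; exists k].
Qed.

(** The search for a pivot: the candidates are tested one after the other, and
    the tree on the branch of candidate [i] may depend on [i]. *)
Lemma derives_nonzero_search P S (I : eqType) (s : seq I) (q : I -> E -> F) T c :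
  s != [::] -> (forall i, i \in s -> S (q i)) ->
  (forall e, P e -> exists2 i, i \in s & q i e != 0) ->
  (forall i, i \in s -> derives (P `&` [set e | q i e != 0]) S T c) ->
  derives P S T (size s + c).
Proof.
elim: s P => [//|i s IH] P _ Sq ex dT.
have [s0|s0] := eqVneq s [::].
  apply: derives_mono (dT i (mem_head _ _)) => //; last by rewrite leq_addl.
  move=> e Pe; split=> //; have [j] := ex e Pe.
  by rewrite s0 inE => /eqP->.
apply: (@derives_ifzero _ _ _ (q i)); first exact/Sq/mem_head.
  apply: IH => // [j js|e [Pe qi0]|j js]; first by apply: Sq; rewrite in_cons js orbT.
    have [j] := ex e Pe; rewrite in_cons => /orP[/eqP->|js qj]; last by exists j.
    by rewrite qi0 eqxx.
  apply: derives_mono (dT j _) => //; last by rewrite in_cons js orbT.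
  by move=> e [[Pe _]].
by apply: derives_mono (dT i (mem_head _ _)) => //; rewrite leq_addl.
Qed.

Lemma solvable_of_derives O (tgt : E -> O -> F) P S T c :
  (forall o, T (tgt^~ o)) -> derives P S T c -> solvable tgt P S c.
Proof.
move=> Tt dT; rewrite -[c]addn0; apply: dT => // P1 _.
by apply: solvable_return => o; right.
Qed.

End Derivability.

Ltac known := solve [ by eauto | left; known | right; known ].
(* The number of operations is an existential variable that the syntax of the
   expression fills in; [derive] then compares it with the bound to be shown. *)
Ltac derive_term := first
  [ apply: derives_known; known
  | eassumption
  | eapply derives_add; derive_term
  | eapply derives_mul; derive_term
  | eapply derives_sub; derive_term
  | apply: derives_zero | apply: derives_one ].
Ltac derive := eapply derives_le; [derive_term | lia].

(** * Strictly triangular matrices given by a two-dimensional state recursion *)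

(** The coefficients of a recursion that reads a sequence [r] and has the state
    [(h, z)]: [rh], [hh] and [zh] are the weights of [r], [h] and [z] in the next
    value of [h], and [rz], [hz] and [zz] those in the next value of [z]. *)
Record linear_filter (F : Type) := LinearFilter {
  rh : nat -> F; hh : nat -> F; zh : nat -> F;
  rz : nat -> F; hz : nat -> F; zz : nat -> F }.

(** What remains of the recurrence relations when a linear functional is applied
    that takes [Q_k] to [h_k] and [x Q_k] to [r_k].  In the first two forms,
    the second state component is the value of the functional at [G_k].  In the
    well-free form it is [beta_(k+1) r_(k-1) + gamma_(k+1) h_(k-1)], which is up to
    sign the contribution of [Q_(k-1)] to [Q_(k+1)]; it is set to zero once
    [Q_(k+1)] is beyond the end of the system. *)
Definition filter_of (F : fieldType) (f : recurrence_form) (r : recurrence F) (n : nat) :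
    linear_filter F :=
  match f with
  | Quasiseparable => LinearFilter
      (fun k => delta r k.+1) (fun k => theta r k.+1) (fun k => gamma r k.+1)
      (fun=> 0) (fun k => beta r k.+1) (fun k => alpha r k.+1)
  | Semiseparable => LinearFilter
      (fun k => delta r k.+1) (fun k => theta r k.+1) (fun k => gamma r k.+1)
      (fun k => beta r k.+1 * delta r k.+1) (fun k => beta r k.+1 * theta r k.+1)
      (fun k => alpha r k.+1)
  | WellFree => LinearFilter
      (fun k => alpha r k.+1) (fun k => 0 - delta r k.+1) (fun=> 0 - 1)
      (fun k => if (k.+2 < n)%N then beta r k.+2 else 0)
      (fun k => if (k.+2 < n)%N then gamma r k.+2 else 0) (fun=> 0)
  end.

Section Filters.
Variable F : fieldType.
Implicit Types (s : linear_filter F) (r y : nat -> F) (k n : nat).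

Fixpoint response s r k : F * F :=
  if k is j.+1 then
    let w := response s r j in
    (rh s j * r j + (hh s j * w.1 + zh s j * w.2),
     rz s j * r j + (hz s j * w.1 + zz s j * w.2))
  else (0, 0).

(** The adjoint state, indexed by the distance [d] from the end: the sum of
    [h_j * y_j] over [n - d <= j <= n], as a function of the state [(h, z)] at time
    [n - d] and of the later input, has the coefficients [costate s y n d] at
    [h] and [z]. *)
Fixpoint costate s y n d : F * F :=
  if d is c.+1 then
    let w := costate s y n c in
    (y (n - d)%N + (hh s (n - d)%N * w.1 + hz s (n - d)%N * w.2),
     zh s (n - d)%N * w.1 + zz s (n - d)%N * w.2)
  else (y n, 0).

Definition coresponse s y n k : F :=
  if (k < n)%N then
    rh s k * (costate s y n (n - k.+1)).1 + rz s k * (costate s y n (n - k.+1)).2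
  else 0.

(** Both sides are the bilinear form of the same matrix, whose rows [response]
    evaluates and whose columns [coresponse] evaluates.  The induction moves the
    time at which forward state and backward state meet. *)
Lemma response_adjoint s r y n :
  \sum_(k < n.+1) (response s r k).1 * y k = \sum_(k < n.+1) r k * coresponse s y n k.
Proof.
(* [rest d] is what the outputs from time [n - d] on contribute. *)
pose rest d := \sum_(n - d <= k < n.+1) (response s r k).1 * y k.
have key d : (d <= n)%N ->
  rest d = (response s r (n - d)%N).1 * (costate s y n d).1
    + (response s r (n - d)%N).2 * (costate s y n d).2
    + \sum_(n - d <= k < n.+1) r k * coresponse s y n k.
  elim: d => [|d IH] dn.
    rewrite /rest subn0 /= !big_nat1 /coresponse ltnn; ring.
  rewrite /rest -(subnSK dn) in IH *; move: (IH (ltnW dn)) => {}IH.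
  have nd : (n - d.+1 <= n)%N by rewrite leq_subr.
  rewrite (@big_ltn _ _ _ (n - d.+1)) ?ltnS // IH.
  rewrite [in RHS](@big_ltn _ _ _ (n - d.+1)) ?ltnS //.
  have -> : coresponse s y n (n - d.+1) =
    rh s (n - d.+1) * (costate s y n d).1 + rz s (n - d.+1) * (costate s y n d).2.
    rewrite /coresponse ifT; last by lia.
    by rewrite (_ : n - (n - d.+1).+1 = d)%N //; lia.
  rewrite /=; ring.
have := key n (leqnn n); rewrite /rest subnn /= !mul0r add0r add0r.
by rewrite !big_mkord.
Qed.

Lemma response_zero s r m : (forall k, (k < m)%N -> r k = 0) -> response s r m = (0, 0).
Proof.
elim: m => [//|m IH] r0 /=; rewrite IH => [|k km]; last exact/r0/leqW.
by rewrite r0 // !mulr0 !addr0.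
Qed.

Definition realizes s n (W : 'M[F]_n.+1) : Prop :=
  forall (v : 'rV_n.+1) (k : 'I_n.+1),
    (v *m W) 0 k = (response s (fun j => v 0 (inord j)) k).1.

Lemma realizes_row s n (W : 'M[F]_n.+1) p (A : 'M[F]_(p, n.+1)) i (k : 'I_n.+1) :
  realizes s W -> (A *m W) i k = (response s (fun j => A i (inord j)) k).1.
Proof.
move=> rW; have := rW (row i A) k; rewrite -row_mul mxE => ->.
by congr (response _ _ _).1; apply: funext => j; rewrite mxE.
Qed.

Lemma realizes_strict_upper s n (W : 'M[F]_n.+1) p (A : 'M[F]_(p, n.+1)) (i : 'I_p) (m : 'I_n.+1) :
  realizes s W -> (forall k : 'I_n.+1, (k < m)%N -> A i k = 0) -> (A *m W) i m = 0.
Proof.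
move=> rW A0; rewrite (realizes_row _ _ _ rW) response_zero // => k km; rewrite A0 // inordK //.
exact: ltn_trans (ltn_ord m).
Qed.

Lemma realizes_column s n (W : 'M[F]_n.+1) (y : 'cV[F]_n.+1) (k : 'I_n.+1) :
  realizes s W -> (W *m y) k 0 = coresponse s (fun j => y (inord j) 0) n k.
Proof.
move=> rW; pose v : 'rV[F]_n.+1 := delta_mx 0 k.
have -> : (W *m y) k 0 = (v *m W *m y) 0 0.
  by rewrite -mulmxA -rowE !mxE.
rewrite mxE; under eq_bigr => j _ do rewrite rW -[j in y j](inord_val j).
rewrite (response_adjoint s (fun j => v 0 (inord j)) (fun j => y (inord j) 0)).
rewrite (bigD1 k) //= inord_val mxE !eqxx mul1r big1 ?addr0 // => j jk.
by rewrite inord_val mxE (negPf jk) andbF mul0r.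
Qed.

End Filters.

(** * The matrix W of a polynomial system *)

Section Realization.
Variable F : fieldType.
Implicit Types (r : recurrence F) (Q : nat -> {poly F}).

(** The polynomials [Q_k] have one of each degree, so a functional with prescribed
    values on them is found by forward substitution. *)
Lemma basis_functional Q (h : nat -> F) n :
  (forall k, (k < n)%N -> size (Q k) = k.+1) ->
  exists c : nat -> F, forall k, (k < n)%N -> \sum_(i < n) (Q k)`_i * c i = h k.
Proof.
elim: n => [|n IH] sQ; first by exists (fun=> 0).
have [c cE] := IH (fun k kn => sQ k (leqW kn)).
have lQ : (Q n)`_n != 0.
  have sn := sQ n (ltnSn n).
  by rewrite (_ : (Q n)`_n = lead_coef (Q n)) ?lead_coef_eq0 -?size_poly_eq0 /lead_coef sn.
pose d := (h n - \sum_(i < n) (Q n)`_i * c i) / (Q n)`_n.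
exists (fun i => if i == n then d else c i) => k; rewrite ltnS leq_eqVlt.
have cE' p : \sum_(i < n) p`_i * (if i == n :> nat then d else c i) = \sum_(i < n) p`_i * c i.
  by apply: eq_bigr => i _; rewrite ltn_eqF.
rewrite big_ord_recr /= eqxx cE' => /orP[/eqP->|kn]; first by rewrite /d; field.
by rewrite cE // [_`_n]nth_default ?mul0r ?addr0 // sQ // leqW.
Qed.

Lemma full_recurrence_tau n Q tau a k :
  (forall k, (k < n)%N -> size (Q k) = k.+1) -> full_recurrence n Q tau a ->
  (k.+1 < n)%N -> tau k.+1 != 0.
Proof.
move=> sQ [_ fQ] kn; apply/eqP => t0.
have := sQ _ kn; rewrite fQ // t0 scale0r sub0r size_polyN => sE.
have : (size (\sum_(j < k.+1) a j k.+1 *: Q j)%R <= k.+1)%N.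
  apply: leq_trans (size_sum _ _ _) _; apply/bigmax_leqP => j _.
  apply: leq_trans (size_scale_leq _ _) _; rewrite sQ //.
  exact: ltn_trans kn.
by rewrite sE ltnn.
Qed.

Lemma MQ_unit n (a : nat -> nat -> F) : MQ n a \in unitmx.
Proof.
rewrite unitmxE -det_tr det_trig; last first.
  by apply/is_trig_mxP => i j ij; rewrite !mxE -val_eqE /= gtn_eqF // ltnNge ltnW.
by rewrite big1 ?unitr1 // => i _; rewrite !mxE eqxx.
Qed.

(** The equation [h = v N M^-1] read column by column in the form [h M = v N]. *)
Lemma WQ_product n (tau : nat -> F) a (v h : 'rV[F]_n.+1) (k : 'I_n.+1) : h = v *m WQ n.+1 tau a ->
  h 0 k + \sum_(j < k) a j k * h 0 (inord j) =
  if (0 < k)%N then v 0 (inord k.-1) * tau k else 0.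
Proof.
move=> hE; have : h *m MQ n.+1 a = v *m NQ n.+1 tau.
  by rewrite hE -!mulmxA mulVmx ?mulmx1 // MQ_unit.
move/matrixP => /(_ 0 k); rewrite !mxE => E.
transitivity (\sum_j h 0 j * MQ n.+1 a j k).
  rewrite (bigD1 k) //= mxE eqxx mulr1; congr (_ + _).
  rewrite (big_ord_widen n.+1 (fun j => a j k * h 0 (inord j))); last exact: ltnW.
  rewrite big_mkcond [RHS]big_mkcond /=; apply: eq_bigr => j _; rewrite mxE.
  by case: (ltngtP j k) => [jk|jk|/val_inj->]; rewrite ?eqxx ?inord_val //=;
    rewrite -val_eqE /= ?(ltn_eqF jk) ?(gtn_eqF jk) ?mulr0 //= mulrC.
rewrite {}E; case: k => -[|i] ik /=.
  by rewrite big1 // => j _; rewrite mxE /= mulr0.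
rewrite (bigD1 (inord i)) //= mxE /= inordK ?eqxx; last exact: ltnW.
rewrite big1 ?addr0 // => j ji; rewrite mxE /= ifF ?mulr0 //.
apply/negP; rewrite eqSS => /eqP ij; case/negP: ji; apply/eqP/val_inj.
by rewrite /= inordK // ltnW.
Qed.

(** The heart of the matter for all three forms: the recurrence relations carry
    over to [h = v W] through the functional [l] with [l (Q_j) = h_j].  The constant
    polynomials do not contribute because [h_0 = 0], so the initial values of the
    recurrence disappear. *)
Lemma WQ_realizes f r n Q tau a :
  (forall k, (k < n.+1)%N -> size (Q k) = k.+1) ->
  defines_system f r n.+1 Q -> full_recurrence n.+1 Q tau a ->
  realizes (filter_of f r n.+1) (WQ n.+1 tau a).
Proof.
move=> sQ [Q0 fQ] aQ v k.
set h := v *m WQ n.+1 tau a.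
pose hn j := h 0 (inord j); pose vn j := v 0 (inord j).
have [c cE] := basis_functional hn sQ.
pose l (p : {poly F}) := \sum_(i < n.+1) p`_i * c i.
have lD p q : l (p + q) = l p + l q.
  by rewrite /l -big_split; apply: eq_bigr => i _; rewrite coefD mulrDl.
have lZ b p : l (b *: p) = b * l p.
  by rewrite /l mulr_sumr; apply: eq_bigr => i _; rewrite coefZ mulrA.
have lS m (b : nat -> F) : l (\sum_(j < m) b j *: Q j) = \sum_(j < m) b j * l (Q j).
  elim: m => [|m IH]; last by rewrite !big_ord_recr /= lD lZ IH.
  by rewrite !big_ord0 -[LHS](congr1 l (scale0r 0)) lZ mul0r.
have hE j : (j < n.+1)%N -> l (Q j) = hn j by exact: cE.
have h0 : hn 0%N = 0.
  have := @WQ_product _ tau a v h (inord 0) erefl.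
  by rewrite /= inordK // big_ord0 addr0.
(* Column [j + 1] of [h M = v N] is [tau * l (x Q_j) = tau * v_j], by the full
   recurrence for [Q_(j+1)]. *)
have xQ j : (j.+1 < n.+1)%N -> l ('X * Q j) = vn j.
  move=> jn; have t0 := full_recurrence_tau sQ aQ jn.
  have := @WQ_product _ tau a v h (inord j.+1) erefl; rewrite /= inordK //= -/(hn _).
  under eq_bigr => i _ do rewrite -/(hn i) -hE ?(ltn_trans (ltn_ord i)) //.
  rewrite -(lS _ (a^~ j.+1)) -hE // -lD; have [_ ->] := aQ; last exact: jn.
  by rewrite subrK lZ mulrC => /(mulIf t0).
have lM b t j : (j.+1 < n.+1)%N ->
    l ((b *: 'X + t%:P) * Q j) = b * vn j + t * hn j.
  by move=> jn; rewrite mulrDl lD -scalerAl lZ xQ // mul_polyC lZ hE // ltnW.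
have l0 b : l b%:P = 0.
  have q0 : initQ r != 0.
    by apply/eqP => q0; have := sQ 0%N (ltn0Sn n); rewrite Q0 q0 size_poly0.
  have -> : b%:P = (b / initQ r) *: Q 0%N by rewrite Q0 -mul_polyC -polyCM divfK.
  by rewrite lZ hE // h0 mulr0.
rewrite -/h -[k in LHS]inord_val -/(hn k); case: k => k /= kn.
case: f fQ => /=.
- move=> [G [G0 GQ]]; suff -> : response (filter_of Quasiseparable r n.+1) vn k = (l (Q k), l (G k)).
    by rewrite hE.
  elim: k kn => [|k IH] kn; first by rewrite /= G0 l0 hE // h0.
  have [-> ->] := GQ k.+1 kn; rewrite /= IH 1?ltnW //=.
  by rewrite !lD !lZ lM // hE 1?ltnW //; congr (_, _); ring.
- move=> [G [G0 GQ]]; suff -> : response (filter_of Semiseparable r n.+1) vn k = (l (Q k), l (G k)).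
    by rewrite hE.
  elim: k kn => [|k IH] kn; first by rewrite /= G0 l0 hE // h0.
  have [-> ->] := GQ k.+1 kn; rewrite /= IH 1?ltnW //=.
  by rewrite !lD !lZ lM // hE 1?ltnW //; congr (_, _); ring.
- move=> WF; pose z j := if j is i.+1 then
    if (i.+2 < n.+1)%N then beta r i.+2 * vn i + gamma r i.+2 * hn i else 0 else 0.
  suff -> : response (filter_of WellFree r n.+1) vn k = (l (Q k), z k) by rewrite hE.
  elim: k kn => [|k IH] kn; first by rewrite /= hE // h0.
  have := WF k.+1 kn; rewrite /= (IH (ltnW kn)) /= => ->.
  rewrite lD -polyCN lM // -scaleN1r lZ (hE k (ltnW kn)).
  congr (_, _); last by case: ifP; rewrite ?mul0r ?addr0 // !mul0r !addr0.
  case: k IH kn => [|k] _ kn; first by rewrite /= -[0 : {poly F}](scale0r 0) lZ; ring.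
  by rewrite /= lM ?(ltnW kn) // kn; ring.
Qed.

End Realization.

(** * Linear-time solution of triangular systems *)

Section Solvers.
Variables (F : fieldType) (E : Type) (P : set E) (S : set (E -> F)).
Variables (s : E -> linear_filter F) (n : nat).

Definition filter_known : Prop := forall k, (k < n)%N ->
  [/\ S (fun e => rh (s e) k), S (fun e => hh (s e) k) & S (fun e => zh (s e) k)] /\
  [/\ S (fun e => rz (s e) k), S (fun e => hz (s e) k) & S (fun e => zz (s e) k)].

Variables (x : E -> F) (v t : nat -> E -> F) (c : nat).
Hypotheses (fS : filter_known) (xS : S x).
Hypothesis tS : forall k, (k <= n)%N -> derives P S [set t k] c.

(** The equation determines [v k] from the state at time [k], which only involves
    earlier values of [v]: the system is triangular. *)
Lemma derives_response :
  (forall e k, P e -> (k <= n)%N ->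
     v k e = x e * ((response (s e) (v^~ e) k).1 + t k e)) ->
  derives P S (\bigcup_(k in `I_n.+1) [set v k]) (n.+1 * (c + 12)).
Proof.
move=> vE.
pose h k e := (response (s e) (v^~ e) k).1; pose z k e := (response (s e) (v^~ e) k).2.
pose T k := [set h k; z k; v k].
suff dT : derives P S (\bigcup_(k in `I_n.+1) T k) (n.+1 * (c + 12)).
  by apply: derives_mono dT => // q [k kn Tq]; right; exists k => //; right.
apply: derives_iter => k; rewrite ltnS => kn.
set S' := S `|` _.
have dh : derives P S' [set h k] 5.
  case: k kn @S' => [|k] kn S'.
    by apply: derives_le (@derives_zero _ _ P S') _.
  have [[S1 S2 S3] _] := fS kn.
  have [hS zS vS] : [/\ S' (h k), S' (z k) & S' (v k)].
    by split; right; exists k => //=; [left; left | left; right | right].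
  rewrite /h /=; derive.
have dz : derives P S' [set z k] 5.
  clear dh; case: k kn @S' => [|k] kn S'.
    by apply: derives_le (@derives_zero _ _ P S') _.
  have [_ [S1 S2 S3]] := fS kn.
  have [hS zS vS] : [/\ S' (h k), S' (z k) & S' (v k)].
    by split; right; exists k => //=; [left; left | left; right | right].
  rewrite /z /=; derive.
have dhz := derives_setU dh dz.
have dv : derives P (S' `|` ([set h k] `|` [set z k])) [set v k] (c + 2).
  apply: (@derives_eq _ _ _ _ (fun e => x e * (h k e + t k e))).
    by move=> e Pe; rewrite -vE.
  have dt : derives P (S' `|` ([set h k] `|` [set z k])) [set t k] c.
    by apply: derives_mono (tS kn) => // q Sq; left; left.
  derive.
by apply: derives_mono (derives_trans dhz dv) => //; lia.
Qed.

(** The same system with the transposed matrix, solved from the last unknown to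
    the first. *)
Lemma derives_coresponse :
  (forall e k, P e -> (k <= n)%N ->
     v k e = x e * (t k e + coresponse (s e) (v^~ e) n k)) ->
  derives P S (\bigcup_(k in `I_n.+1) [set v k]) (n.+1 * (c + 14)).
Proof.
move=> vE.
pose l d e := (costate (s e) (v^~ e) n d).1; pose m d e := (costate (s e) (v^~ e) n d).2.
pose T d := [set v (n - d)%N] `|` [set l d] `|` [set m d].
suff dT : derives P S (\bigcup_(d in `I_n.+1) T d) (n.+1 * (c + 14)).
  apply: derives_mono dT => // q [k /= kn ->]; right; exists (n - k)%N => /=; first by lia.
  by left; left; rewrite subKn.
apply: derives_iter => d; rewrite ltnS => dn.
have dt' S' : S `<=` S' -> derives P S' [set t (n - d)%N] c.
  by move=> sS; apply: derives_mono (tS _) => //; rewrite leq_subr.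
case: d dn dt' => [|d] dn dt'; set S' := S `|` _.
  have dv : derives P S' [set v n] (c + 3).
    apply: (@derives_eq _ _ _ _ (fun e => x e * (t n e + 0))).
      by move=> e Pe; rewrite vE // /coresponse ltnn.
    have := dt' S'; rewrite subn0 => dt.
    have {}dt := dt (@subsetUl _ _ _).
    derive.
  have dl : derives P (S' `|` [set v n]) [set l 0%N] 0.
    by apply: (@derives_eq _ _ _ _ (v n)) => [e _|]; [by [] | derive].
  have dm : derives P (S' `|` ([set v n] `|` [set l 0%N])) [set m 0%N] 1.
    exact: (@derives_zero _ _ P).
  rewrite /T subn0.
  by apply: derives_mono (derives_trans (derives_trans dv dl) dm) => //; lia.
have dk : (n - d.+1 < n)%N by lia.
have [[S1 S2 S3] [S4 S5 S6]] := fS dk.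
have [lS mS] : S' (l d) /\ S' (m d).
  by split; right; exists d => //=; [left; right | right].
have {}dt' := dt' S' (@subsetUl _ _ _).
have dv : derives P S' [set v (n - d.+1)%N] (c + 6).
  apply: (@derives_eq _ _ _ _ (fun e => x e * (t (n - d.+1)%N e +
      (rh (s e) (n - d.+1) * l d e + rz (s e) (n - d.+1) * m d e)))).
    move=> e Pe; rewrite vE ?leq_subr // /coresponse ifT; last by lia.
    by rewrite (_ : n - (n - d.+1).+1 = d)%N //; lia.
  derive.
have dl : derives P (S' `|` [set v (n - d.+1)%N]) [set l d.+1] 4.
  rewrite /l /=; derive.
have dm : derives P (S' `|` ([set v (n - d.+1)%N] `|` [set l d.+1])) [set m d.+1] 3.
  rewrite /m /=; derive.
by apply: derives_mono (derives_trans (derives_trans dv dl) dm) => //; lia.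
Qed.

End Solvers.

(** * Gaussian elimination under the displacement equation *)

Section Elimination.
Variables (F : fieldType) (n p : nat).
Implicit Types (I : {set 'I_n.+1}) (x : 'I_n.+1 -> F) (R W : 'M[F]_n.+1).
Implicit Types (G X : 'M[F]_(n.+1, p)) (B Y : 'M[F]_(p, n.+1)).

Lemma submxE a b (A C : 'M[F]_(a, b)) i j : (A - C) i j = A i j - C i j.
Proof. by rewrite !mxE. Qed.

Definition rank_one_update a b (A : 'M[F]_(a, b)) (d : F) (u : 'cV[F]_a) (v : 'rV[F]_b) :=
  A - (d^-1 *: u) *m v.

Lemma rank_one_updateE a b (A : 'M[F]_(a, b)) d u v i j :
  rank_one_update A d u v i j = A i j - u i 0 / d * v 0 j.
Proof. by rewrite !mxE big_ord1 !mxE [_^-1 * _]mulrC. Qed.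

(** The state of the elimination: [I] is the set of pivot rows used so far, and
    the columns used are the first [#|I|] ones.  The third condition says that the
    kernel of [R] is no larger than the eliminated columns force it to be, and is
    what provides the next pivot. *)
Definition reduced I x W X Y R G B : Prop :=
  [/\ Dinv x *m R - R *m W = G *m B,
      forall i k : 'I_n.+1, (k < #|I|)%N || (i \in I) -> R i k = 0,
      forall v : 'cV_n.+1, R *m v = 0 -> forall k : 'I_n.+1, (#|I| <= k)%N -> v k 0 = 0
    & R *m X = G /\ Y *m R = B].

Lemma Dinv_mulE x q (A : 'M[F]_(n.+1, q)) i k : (Dinv x *m A) i k = (x i)^-1 * A i k.
Proof. by rewrite mul_diag_mx !mxE. Qed.

Lemma mulmx_diag q (A : 'M[F]_(q, n.+1)) x i k : (A *m Dinv x) i k = A i k * (x k)^-1.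
Proof. by rewrite mul_mx_diag !mxE. Qed.

Section Step.
Variables (s : linear_filter F) (I : {set 'I_n.+1}) (x : 'I_n.+1 -> F) (W R : 'M[F]_n.+1).
Variables (X G : 'M[F]_(n.+1, p)) (Y B : 'M[F]_(p, n.+1)) (m : 'I_n.+1).
Hypotheses (sW : realizes s W) (x0 : forall i, x i != 0).
Hypotheses (RI : reduced I x W X Y R G B) (mI : m = #|I| :> nat).

Lemma reduced_entry i k : R i k = x i * ((R *m W) i k + (G *m B) i k).
Proof.
have [<- _ _ _] := RI.
by rewrite submxE Dinv_mulE addrC subrK mulrA divff ?mul1r.
Qed.

(** The earlier columns of [R] vanish and [W] is strictly upper triangular; in
    particular column [m] of [R] can be read off from [G] and [B] alone. *)
Lemma reduced_strict i : (R *m W) i m = 0.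
Proof.
have [_ R0 _ _] := RI; apply: (realizes_strict_upper sW) => k km.
by rewrite R0 // -mI km.
Qed.

Lemma reduced_pivot : exists2 i, i \in ~: I & R i m != 0.
Proof.
have [_ R0 kR _] := RI; apply: contrapT => noi.
have Rm : R *m (delta_mx m 0 : 'cV_n.+1) = 0.
  apply/matrixP => i j; rewrite ord1 -colE !mxE; apply/eqP/negPn/negP => Rim.
  apply: noi; exists i => //; rewrite inE; apply/negP => iI.
  by case/eqP: Rim; rewrite R0 // iI orbT.
have := kR _ Rm m; rewrite mI leqnn => /(_ isT)/eqP.
by rewrite mxE !eqxx oner_eq0.
Qed.

Variables (i0 : 'I_n.+1).
Hypothesis Rim : R i0 m != 0.

Lemma pivot_fresh : i0 \notin I.
Proof. by apply: contra_neqN Rim => iI; have [_ -> //] := RI; rewrite iI orbT. Qed.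

(** Since [D] is diagonal, [D] applied to the rank-one correction differs from
    the value demanded by row [i0] of the displacement equation by
    [1/x_i - 1/x_i0] in row [i]; this discrepancy is what the correction of [B]
    accounts for, by [reduced_strict].  The solutions [X] and [Y] are unaffected
    because multiples of row [i0] of [R X = G] and of column [m] of [Y R = B] are
    subtracted from the others. *)
Lemma reduced_step :
  reduced (i0 |: I) x W X Y (rank_one_update R (R i0 m) (col m R) (row i0 R))
    (rank_one_update G (R i0 m) (col m R) (row i0 G))
    (rank_one_update B (R i0 m) (col m B) (row i0 R)).
Proof.
have cI : #|i0 |: I| = m.+1 by rewrite cardsU1 pivot_fresh mI.
have [dR R0 kR [XG YB]] := RI.
split; rewrite ?cI.
- apply/matrixP => i k; rewrite submxE Dinv_mulE rank_one_updateE.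
  have -> : (rank_one_update R (R i0 m) (col m R) (row i0 R) *m W) i k =
      (R *m W) i k - R i m / R i0 m * (R *m W) i0 k.
    have <- : rank_one_update (R *m W) (R i0 m) (col m R) (row i0 (R *m W)) i k =
        (R *m W) i k - R i m / R i0 m * (R *m W) i0 k.
      by rewrite rank_one_updateE ![col _ _ _ _]mxE ![row _ _ _ _]mxE.
    by rewrite /rank_one_update row_mul mulmxA mulmxBl.
  have -> : (rank_one_update G (R i0 m) (col m R) (row i0 G) *m
     rank_one_update B (R i0 m) (col m B) (row i0 R)) i k =
     (G *m B) i k - R i m / R i0 m * (G *m B) i0 k
     - ((G *m B) i m - R i m / R i0 m * (G *m B) i0 m) / R i0 m * R i0 k.
    pose GB := G *m B; pose d := R i0 m.
    have -> : rank_one_update G d (col m R) (row i0 G)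
        *m rank_one_update B d (col m B) (row i0 R) =
      rank_one_update (rank_one_update GB d (col m R) (row i0 GB)) d
        (col m (rank_one_update GB d (col m R) (row i0 GB))) (row i0 R).
      have -> : rank_one_update GB d (col m R) (row i0 GB) =
          rank_one_update G d (col m R) (row i0 G) *m B.
        by rewrite /rank_one_update mulmxBl -mulmxA row_mul.
      by rewrite {2 4}/rank_one_update mulmxBr mulmxA -scalemxAr !colE mulmxA.
    by rewrite rank_one_updateE ![col _ _ _ _]mxE ![row _ _ _ _]mxE !rank_one_updateE
      ![col _ _ _ _]mxE ![row _ _ _ _]mxE.
  have gE i' k' : (G *m B) i' k' = (x i')^-1 * R i' k' - (R *m W) i' k'.
    by rewrite -dR submxE Dinv_mulE.
  rewrite !gE !reduced_strict !mxE.
  field.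
  by rewrite Rim !x0.
- move=> i k; rewrite rank_one_updateE !mxE ltnS leq_eqVlt in_setU1 -!orbA.
  case/or4P => [/eqP km|km|/eqP->|iI].
  + by rewrite (val_inj km) divfK ?subrr.
  + have R0k j : R j k = 0 by rewrite R0 // -mI km.
    by rewrite !R0k mulr0 subr0.
  + by rewrite divff // mul1r subrr.
  + have R0i j : R i j = 0 by rewrite R0 // iI orbT.
    by rewrite !R0i !mul0r subr0.
- move=> v; rewrite mulmxBl => /eqP; rewrite subr_eq0 => /eqP Rv k mk.
  (* Correcting [v] in coordinate [m] moves it into the kernel of the old [R]. *)
  pose w := (R i0 m)^-1 * (row i0 R *m v) 0 0.
  have /kR/(_ k) : R *m (v - w *: delta_mx m 0) = 0.
    rewrite mulmxBr -scalemxAr -colE Rv -mulmxA [row i0 R *m v]mx11_scalar.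
    by rewrite mul_mx_scalar scalerA mulrC subrr.
  rewrite -mI (ltnW mk) => /(_ isT); rewrite !mxE.
  by rewrite -val_eqE /= gtn_eqF // mulr0 subr0.
- split.
  + rewrite mulmxBl XG -mulmxA -row_mul XG //.
  + rewrite mulmxBr YB mulmxA -scalemxAr colE mulmxA YB -colE //.
Qed.

End Step.
End Elimination.

(** * Computing the generators of the inverse *)

Definition entries (F : fieldType) E a b (A : E -> 'M[F]_(a, b)) : set (E -> F) :=
  \bigcup_i \bigcup_j [set fun e => A e i j].

Lemma mem_entries (F : fieldType) E a b (A : E -> 'M[F]_(a, b)) i j :
  entries A (fun e => A e i j).
Proof. by exists i => //; exists j. Qed.
#[local] Hint Resolve mem_entries : core.

Lemma size_index_enum (I : finType) : size (index_enum I) = #|I|.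
Proof. by rewrite cardT enumT. Qed.

Lemma derives_ord (F : fieldType) E (P : set E) (S : set (E -> F)) N (T : 'I_N -> set (E -> F)) c :
  (forall i, derives P S (T i) c) -> derives P S (\bigcup_i T i) (N * c).
Proof. by move=> /derives_family; rewrite card_ord. Qed.

Lemma derives_sum_ord (F : fieldType) E (P : set E) (S : set (E -> F)) N (Q : pred 'I_N) f c :
  (forall i, Q i -> derives P S [set f i] c) ->
  derives P S [set fun e => \sum_(i | Q i) f i e] (N * c.+1).+1.
Proof.
by move=> df; have := @derives_sum _ _ P S _ (index_enum 'I_N) Q f c df; rewrite size_index_enum card_ord.
Qed.

Lemma derives_entries (F : fieldType) E P S a b (A : E -> 'M[F]_(a, b)) c :
  (forall i j, derives P S [set fun e => A e i j] c) ->
  derives P S (entries A) (a * (b * c)).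
Proof.
by move=> dA; apply: derives_ord => i; apply: derives_ord => j.
Qed.

Lemma derives_dot (F : fieldType) E (P : set E) S p (f g : 'I_p -> E -> F) :
  (forall j, S (f j)) -> (forall j, S (g j)) ->
  derives P S [set fun e => \sum_j f j e * g j e] (2 * p).+1.
Proof.
by move=> Sf Sg; rewrite mulnC; apply: derives_sum_ord => j _; derive.
Qed.

Lemma derives_rank_one_update (F : fieldType) E (P : set E) S a b (A : E -> 'M[F]_(a, b))
    (d : E -> F) (u : E -> 'cV[F]_a) (v : E -> 'rV[F]_b) :
  (forall e, P e -> d e != 0) -> entries A `<=` S -> S d ->
  (forall i, S (fun e => u e i 0)) -> (forall j, S (fun e => v e 0 j)) ->
  derives P S (entries (fun e => rank_one_update (A e) (d e) (u e) (v e))) (a * (b * 3)).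
Proof.
move=> d0 AS dS uS vS; apply: derives_entries => i j.
apply: (@derives_eq _ _ _ _ (fun e => A e i j - u e i 0 / d e * v e 0 j)).
  by move=> e _; rewrite rank_one_updateE.
have AijS : S (fun e => A e i j) by exact: AS.
have du : derives P S [set fun e => u e i 0 / d e] 1.
  by apply: (@derives_div _ _ _ _ _ _ 0 0) => //; apply: derives_known.
derive.
Qed.

Section Generators.
Variables (F : fieldType) (E : Type) (n p : nat).
Variables (s : E -> linear_filter F) (x : 'I_n.+1 -> E -> F) (W : E -> 'M[F]_n.+1).
Variables (X : E -> 'M[F]_(n.+1, p)) (Y : E -> 'M[F]_(p, n.+1)).

(** The rows of [X] and columns of [Y] that the steps after [I] determine. *)
Definition solved_part (I : {set 'I_n.+1}) : set (E -> F) :=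
  (\bigcup_(k in [set k : 'I_n.+1 | #|I| <= k]%N) \bigcup_j [set fun e => X e k j])
  `|` (\bigcup_(i in [set i | i \notin I]) \bigcup_j [set fun e => Y e j i]).

(** Induction on the number [d] of steps left.  [R] is never computed as a whole:
    of it only the pivot column, from [G] and [B], and the pivot row, by
    [derives_response], are found.  After the remaining steps, the pivot row of
    [R X = G] and the pivot column of [Y R = B] yield one more row of [X] and one
    more column of [Y]. *)
Lemma derives_generators d (I : {set 'I_n.+1}) (P : set E) (S : set (E -> F))
    (R : E -> 'M[F]_n.+1) (G : E -> 'M[F]_(n.+1, p)) (B : E -> 'M[F]_(p, n.+1)) :
  (0 < p)%N -> #|~: I| = d ->
  (forall e, P e -> [/\ realizes (s e) (W e), forall i, x i e != 0
     & reduced I (x^~ e) (W e) (X e) (Y e) (R e) (G e) (B e)]) ->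
  filter_known S s n -> (forall i, S (x i)) -> entries G `<=` S -> entries B `<=` S ->
  derives P S (solved_part I) (d * (50 * (p * n.+1))).
Proof.
move=> p0; elim: d I P S R G B => [|d IH] I P S R G B cI RI fS xS GS BS.
  apply: derives_refl => q [[k /= + _]|[i /= iI _]].
    have := cardsC I; rewrite cI addn0 card_ord => -> /(leq_trans (ltn_ord k)).
    by rewrite ltnn.
  by have /setP/(_ i) := cards0_eq cI; rewrite !inE iI.
have In : (#|I| < n.+1)%N by have := cardsC I; rewrite card_ord cI; lia.
pose m := Ordinal In; have mI : m = #|I| :> nat by [].
have GijS i j : S (fun e => G e i j) by exact: GS.
have BijS i j : S (fun e => B e i j) by exact: BS.
have rE e i k : P e -> R e i k = x i e *
    ((response (s e) (fun j => R e i (inord j)) k).1 + \sum_j G e i j * B e j k).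
  by move=> /RI[sW x0 red]; rewrite (reduced_entry x0 red) (realizes_row _ _ _ sW) [(_ *m B e) _ _]mxE.
pose T1 := \bigcup_i [set fun e => R e i m].
have d1 : derives P S T1 (n.+1 * (2 * p + 2)).
  apply: derives_ord => i.
  apply: (@derives_eq _ _ _ _ (fun e => x i e * \sum_j G e i j * B e j m)).
    move=> e /RI[sW x0 red].
    by rewrite (reduced_entry x0 red) (reduced_strict sW red mI) add0r [(_ *m B e) _ _]mxE.
  have := @derives_dot _ _ P S p (fun j e => G e i j) (fun j e => B e j m).
  move=> /(_ (GijS i) (BijS^~ m)) dGB; derive.
(* Every cut spends a part of the 50 p (n + 1) operations that the step may take.
   Since p > 0, this also pays for what only depends on n, such as the search. *)
apply: (derives_cut d1 (c2 := n.+1 + (d * (50 * (p * n.+1)) + 40 * (p * n.+1)))); last by nia.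
apply: derives_mono (@derives_nonzero_search _ _ P (S `|` T1) _ (enum (~: I)) (fun i e => R e i m)
  (solved_part I) (d * (50 * (p * n.+1)) + 40 * (p * n.+1)) _ _ _ _) => //.
- by rewrite -cardE leq_add2r -[X in (_ <= X)%N]card_ord max_card.
- by rewrite -size_eq0 -cardE cI.
- by move=> i _; right; exists i.
- move=> e /RI[sW x0 red]; have [i iI Ri] := reduced_pivot red mI.
  by exists i => //; rewrite mem_enum.
move=> i0; rewrite mem_enum inE => i0I.
set P' := P `&` _; set S1 := S `|` T1.
have RmS i : S1 (fun e => R e i m) by right; exists i.
pose T2 := \bigcup_(k in `I_n.+1) [set fun e => R e i0 (inord k)].
have d2 : derives P' S1 T2 (n.+1 * ((2 * p).+1 + 12)).
  apply: derives_mono (@derives_response _ _ P' S1 s n (x i0) (fun k e => R e i0 (inord k))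
    (fun k e => \sum_j G e i0 j * B e j (inord k)) (2 * p).+1 _ _ _ _) => //.
  - by move=> k kn; have [[? ? ?] [? ? ?]] := fS k kn; split; split; left.
  - by left.
  - by move=> k kn; apply: derives_dot => j; left.
  - by move=> e k [Pe _] kn; rewrite rE // inordK.
apply: (derives_cut d2 (c2 := d * (50 * (p * n.+1)) + 24 * (p * n.+1))); last by nia.
set S2 := S1 `|` T2.
have R0S k : S2 (fun e => R e i0 k).
  by right; exists k => /=; rewrite ?inord_val.
pose G' e := rank_one_update (G e) (R e i0 m) (col m (R e)) (row i0 (G e)).
pose B' e := rank_one_update (B e) (R e i0 m) (col m (B e)) (row i0 (R e)).
have piv0 e : P' e -> R e i0 m != 0 by case.
have mxS (q q' : E -> F) (U : set (E -> F)) : q = q' -> U q -> U q' by move=> ->.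
have d3 : derives P' S2 (entries G') (n.+1 * (p * 3)).
  apply: derives_rank_one_update => // [q /GS Sq|i|j]; first by left; left.
    by apply: (@mxS (fun e => R e i m)); [apply: funext => e; rewrite mxE | left].
  by apply: (@mxS (fun e => G e i0 j)); [apply: funext => e; rewrite mxE | left; left].
apply: (derives_cut d3 (c2 := d * (50 * (p * n.+1)) + 21 * (p * n.+1))); last by nia.
set S3 := S2 `|` _.
have d4 : derives P' S3 (entries B') (p * (n.+1 * 3)).
  apply: derives_rank_one_update => // [q /BS Sq||i|j]; first by left; left; left.
  - by left.
  - by apply: (@mxS (fun e => B e i m)); [apply: funext => e; rewrite mxE | left; left; left].
  by apply: (@mxS (fun e => R e i0 j)); [apply: funext => e; rewrite mxE | left].
apply: (derives_cut d4 (c2 := d * (50 * (p * n.+1)) + 18 * (p * n.+1))); last by nia.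
set S4 := S3 `|` _.
have SS4 : S `<=` S4 by move=> q Sq; left; left; left; left.
have cI' : #|~: (i0 |: I)| = d.
  by have := cardsC (i0 |: I); have := cardsC I; rewrite cardsU1 i0I cI /= card_ord; lia.
have d5 : derives P' S4 (solved_part (i0 |: I)) (d * (50 * (p * n.+1))).
  apply: (IH _ _ _ (fun e => rank_one_update (R e) (R e i0 m) (col m (R e)) (row i0 (R e)))
    G' B') => //.
  - move=> e [/RI[sW x0 red] Rim]; split=> //; exact: reduced_step.
  - by move=> k kn; have [[? ? ?] [? ? ?]] := fS k kn; split; split; apply: SS4.
  - by move=> i; apply: SS4.
  - by move=> q ?; left; right.
  - by move=> q ?; right.
apply: (derives_cut d5 (c2 := 18 * (p * n.+1))); last by nia.
set S5 := S4 `|` _.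
have cI1 : #|i0 |: I| = m.+1 by rewrite cardsU1 i0I mI.
have pivS : S5 (fun e => R e i0 m) by left; left; left; apply: R0S.
pose TX := \bigcup_j [set fun e => X e m j].
pose TY := \bigcup_j [set fun e => Y e j i0].
have dX : derives P' S5 TX (p * (2 * n.+1 + 3)).
  apply: derives_ord => j.
  apply: (@derives_eq _ _ _ _
    (fun e => (G e i0 j - \sum_(k : 'I_n.+1 | (m < k)%N) R e i0 k * X e k j) / R e i0 m)).
    move=> e [/RI[sW x0 [_ R0 _ [XG _]]] Rim].
    (* [R i0 k = 0] for [k < m], so only rows of [X] from later steps enter. *)
    rewrite -XG mxE (bigD1 m) //= (bigID (fun k : 'I_n.+1 => (m < k)%N)) /=.
    rewrite [X in _ + (_ + X)]big1 ?addr0 => [|k /andP[km]]; last first.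
      rewrite -leqNgt => km'; rewrite R0 ?mul0r //; apply/orP; left.
      by rewrite -mI ltn_neqAle km' val_eqE km.
    rewrite (eq_bigl (fun k : 'I_n.+1 => (m < k)%N)) => [|k].
      by rewrite addrK mulrC mulKf.
    by case: eqVneq => [->|]; rewrite ?ltnn.
  have dsum : derives P' S5 [set fun e => \sum_(k : 'I_n.+1 | (m < k)%N) R e i0 k * X e k j] (2 * n.+1).+1.
    rewrite mulnC; apply: derives_sum_ord => k mk.
    have RS : S5 (fun e => R e i0 k) by left; left; left; apply: R0S.
    have XS : S5 (fun e => X e k j).
      by right; left; exists k => /=; [rewrite cI1 | exists j].
    derive.
  have dnum : derives P' S5 [set fun e => G e i0 j - \sum_(k : 'I_n.+1 | (m < k)%N) R e i0 k * X e k j]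
      (2 * n.+1).+2.
    have GS5 : S5 (fun e => G e i0 j) by left; apply: SS4.
    derive.
  apply: (@derives_le _ _ _ _ _ ((2 * n.+1).+2 + 0).+1); last by lia.
  by apply: derives_div => //; exact: derives_known.
have dY : derives P' S5 TY (p * (2 * n.+1 + 3)).
  apply: derives_ord => j.
  apply: (@derives_eq _ _ _ _
    (fun e => (B e j m - \sum_(i | i \notin i0 |: I) Y e j i * R e i m) / R e i0 m)).
    move=> e [/RI[sW x0 [_ R0 _ [_ YB]]] Rim].
    (* The rows of [R] in [I] vanish, so only columns of [Y] from later steps
       enter. *)
    rewrite -YB mxE (bigD1 i0) //= (bigID (mem I)) /=.
    rewrite [X in _ + (X + _)]big1 ?add0r => [|i /andP[_ iI]]; last first.
      by rewrite R0 ?iI ?orbT // mulr0.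
    rewrite (eq_bigl (fun i => i \notin i0 |: I)) => [|i].
      by rewrite addrK mulfK.
    by rewrite in_setU1 negb_or.
  have dsum : derives P' S5 [set fun e => \sum_(i | i \notin i0 |: I) Y e j i * R e i m]
      (2 * n.+1).+1.
    rewrite mulnC; apply: derives_sum_ord => i iI.
    have RS : S5 (fun e => R e i m) by left; left; left; left; apply: RmS.
    have YS : S5 (fun e => Y e j i).
      by right; right; exists i => //=; exists j.
    derive.
  have dnum : derives P' S5 [set fun e => B e j m - \sum_(i | i \notin i0 |: I) Y e j i * R e i m]
      (2 * n.+1).+2.
    have BS5 : S5 (fun e => B e j m) by left; apply: SS4.
    derive.
  apply: (@derives_le _ _ _ _ _ ((2 * n.+1).+2 + 0).+1); last by lia.
  by apply: derives_div => //; exact: derives_known.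
apply: derives_mono (derives_setU dX dY) => //; last by nia.
move=> q [[k /= Ik [j _ qE]]|[i /= iI [j _ qE]]]; last first.
  have [ii0|ii0] := eqVneq i i0; first by right; right; exists j; rewrite // -ii0.
  left; right; right; exists i => /=; first by rewrite in_setU1 (negPf ii0).
  by exists j.
have [km|km] := eqVneq k m; first by right; left; exists j; rewrite // -km.
left; right; left; exists k => /=; last by exists j.
by rewrite cI1 ltn_neqAle eq_sym km.
Qed.

End Generators.

(** * The inverse matrix *)

(** An instance contains, besides the data given to the algorithm, the matrix
    [solution] to be inverted and the matrix [opW] of the displacement equation.
    These two are known to the analysis only. *)
Record problem (F : fieldType) (n p : nat) := Problem {
  coeffs : recurrence F;
  genG : 'M[F]_(n, p);
  genB : 'M[F]_(p, n);
  nodes : 'I_n -> F;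
  opW : 'M[F]_n;
  solution : 'M[F]_n }.

Section Inversion.
Variables (F : fieldType) (f : recurrence_form) (n p : nat).
Let E := problem F n.+1 p.
Let s (e : E) := filter_of f (coeffs e) n.+1.
Let value (e : E) := input_value (coeffs e) (genG e) (genB e) (nodes e).
Let inputs : set (E -> F) := range (fun v e => value e v).

Definition invertible_problem : set E := [set e |
  [/\ realizes (s e) (opW e), forall i, nodes e i != 0,
      Dinv (nodes e) *m solution e - solution e *m opW e = genG e *m genB e
    & solution e \in unitmx]].

Lemma derives_filter P : exists2 T,
  derives P inputs T (n * 18) & filter_known (inputs `|` T) s n.
Proof.
pose T k :=
  [set fun e => rh (s e) k; fun e => hh (s e) k; fun e => zh (s e) k] `|`
  [set fun e => rz (s e) k; fun e => hz (s e) k; fun e => zz (s e) k].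
exists (\bigcup_(k : 'I_n) T k); last first.
  move=> k kn; have Tk : T k `<=` inputs `|` \bigcup_(k : 'I_n) T k.
    by move=> q Tq; right; exists (Ordinal kn).
  split; split; apply: Tk.
  - by left; left; left.
  - by left; left; right.
  - by left; right.
  - by right; left; left.
  - by right; left; right.
  - by right; right.
apply: derives_ord => k.
have inputS v : inputs (fun e => value e v) by exists v.
have ka := inputS (@InAlpha n.+1 p k); have kb := inputS (@InBeta n.+1 p k).
have kg := inputS (@InGamma n.+1 p k); have kd := inputS (@InDelta n.+1 p k); have kt := inputS (@InTheta n.+1 p k).
pose easy q := derives P inputs [set q] 3.
have dall : [/\ easy (fun e => rh (s e) k), easy (fun e => hh (s e) k) & easy (fun e => zh (s e) k)] /\
  [/\ easy (fun e => rz (s e) k), easy (fun e => hz (s e) k) & easy (fun e => zz (s e) k)].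
  have d0 := @derives_zero _ _ P inputs; have d1 := @derives_one _ _ P inputs.
  rewrite /easy /s; case: (f) => /=.
  - by split; split; derive.
  - by split; split; derive.
  - split; split; try derive.
      have [kn|kn] := ltnP k.+2 n.+1; last derive.
      have kb2 := inputS (@InBeta n.+1 p (Ordinal (kn : k.+1 < n.+1.-1)%N)); derive.
    have [kn|kn] := ltnP k.+2 n.+1; last derive.
    have kg2 := inputS (@InGamma n.+1 p (Ordinal (kn : k.+1 < n.+1.-1)%N)); derive.
have [[e1 e2 e3] [e4 e5 e6]] := dall.
exact: (derives_setU (derives_setU (derives_setU e1 e2) e3)
  (derives_setU (derives_setU e4 e5) e6)).
Qed.

(** With the first component [set0] of [reduced], no row has been eliminated yet
    and the elimination yields all of [X] and [Y].  Column [i] of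
    [R^-1 D - W R^-1 = X Y] then is a triangular system for column [i] of the
    inverse. *)
Lemma derives_inverse : (0 < p)%N ->
  derives invertible_problem inputs (entries (fun e => invmx (solution e)))
    (90 * (p * n.+1 ^ 2)).
Proof.
move=> p0; set P := invertible_problem.
have [Tf df fS] := derives_filter P.
apply: (derives_cut df (c2 := 80 * (p * n.+1 ^ 2))); last by nia.
set S1 := inputs `|` Tf.
have inputS v : S1 (fun e => value e v) by left; exists v.
pose X (e : E) := invmx (solution e) *m genG e; pose Y (e : E) := genB e *m invmx (solution e).
have d2 : derives P S1 (solved_part X Y finset.set0) (n.+1 * (50 * (p * n.+1))).
  apply: (@derives_generators _ _ _ _ s (fun i e => nodes e i) (@opW _ _ _) X Y _ _ _ _
    (@solution _ _ _) (@genG _ _ _) (@genB _ _ _)) => //.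
  - by rewrite finset.setC0 cardsT card_ord.
  - move=> e [sW x0 dR uR]; split=> //; split=> //.
    + by move=> i k; rewrite cards0 inE.
    + by move=> v Rv k _; rewrite -[v](mulKmx uR) Rv mulmx0 mxE.
    + by rewrite /X /Y mulKVmx // mulmxKV.
  - by move=> i; apply: (inputS (InX _ i)).
  - by move=> q [i _ [j _ ->]]; apply: (inputS (InG i j)).
  - by move=> q [i _ [j _ ->]]; apply: (inputS (InB i j)).
apply: (derives_cut d2 (c2 := n.+1 * (n.+1 * ((2 * p).+1 + 14)))); last by nia.
set S2 := S1 `|` _.
pose col_entries (i : 'I_n.+1) : set (E -> F) :=
  \bigcup_(k in `I_n.+1) [set fun e => invmx (solution e) (inord k) i].
suff dc i : derives P S2 (col_entries i) (n.+1 * ((2 * p).+1 + 14)).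
  apply: derives_mono (derives_ord dc) => // q [i _ [j _ ->]]; right.
  by exists j => //; exists i => /=; rewrite ?inord_val.
apply: derives_mono (@derives_coresponse _ _ P S2 s n (fun e => nodes e i)
    (fun k e => invmx (solution e) (inord k) i)
    (fun k e => \sum_j X e (inord k) j * Y e j i) (2 * p).+1 _ _ _ _) => //.
- by move=> k kn; have [[? ? ?] [? ? ?]] := fS k kn; split; split; left.
- by left; apply: (inputS (InX _ i)).
- move=> k kn; apply: derives_dot => j; right.
    by left; exists (inord k) => /=; [rewrite cards0 | exists j].
  by right; exists i; [rewrite /= inE | exists j].
- move=> e k [sW x0 dR uR] kn.
  have /matrixP/(_ (inord k) i) : invmx (solution e) *m Dinv (nodes e)
      - opW e *m invmx (solution e) = X e *m Y e.
    rewrite /X /Y mulmxA -[_ *m genG e *m _]mulmxA -dR mulmxBr mulmxBl.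
    rewrite mulmxA mulmxK // [_ *m (solution e *m _)]mulmxA mulVmx // mul1mx //.
  rewrite submxE mulmx_diag [X in _ = X]mxE => <-.
  rewrite -[in coresponse _ _ _ k](@inordK n k) //.
  rewrite -[X in coresponse _ X](_ : (fun j => col i (invmx (solution e)) (inord j) 0) = _); last first.
    by apply: funext => j; rewrite mxE.
  rewrite -(realizes_column (col i (invmx (solution e))) _ sW).
  rewrite !colE mulmxA -colE [col _ _ _ _]mxE subrK mulrC divfK //.
Qed.

End Inversion.

Local Open Scope complex_scope.

Theorem theorem7p1 (K : realType) :
  exists c : nat,
  forall (f : recurrence_form) (n p : nat), (0 < n)%N ->
  exists t : comp_tree ('I_n * 'I_n) (input n p),
  forall (r : recurrence K[i]) (Q : nat -> {poly K[i]})
         (tau : nat -> K[i]) (a : nat -> nat -> K[i])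
         (G : 'M[K[i]]_(n, p)) (B : 'M[K[i]]_(p, n))
         (x : 'I_n -> K[i]) (R : 'M[K[i]]_n),
  (forall k, (k < n)%N -> size (Q k) = k.+1) ->
  defines_system f r n Q ->
  full_recurrence n Q tau a ->
  (forall i, x i != 0) ->
  Dinv x *m R - R *m WQ n tau a = G *m B ->
  R \in unitmx ->
  exists (out : 'I_n * 'I_n -> K[i]) (k : nat),
    [/\ run t (input_value r G B x) = Some (out, k),
        (k <= c * (p * n ^ 2))%N
      & forall i j, out (i, j) = invmx R i j].
Proof.
exists 90%N => f [//|n] p _; have [->|p0] := posnP p.
  exists (Return (fun=> InInitQ _ _)) => r Q tau a G B x R sQ dQ fQ x0 dR uR.
  have sW := WQ_realizes sQ dQ fQ; exfalso.
  have R0 i : R i 0 = 0.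
    have /matrixP/(_ i 0) := dR.
    rewrite submxE Dinv_mulE (realizes_row _ _ _ sW) subr0 [in RHS]mxE big_ord0.
    by move/eqP; rewrite mulf_eq0 invr_eq0 (negPf (x0 i)) => /eqP.
  have := congr1 (fun A : 'M_n.+1 => A 0 0) (mulVmx uR).
  rewrite !mxE /= big1 => [/eqP|j _]; last by rewrite R0 mulr0.
  by rewrite eq_sym oner_eq0.
have : solvable (fun (e : problem K[i] n.+1 p) o => invmx (solution e) o.1 o.2)
   (@invertible_problem _ f n p)
   (range (fun v e => input_value (coeffs e) (genG e) (genB e) (nodes e) v))
   (90 * (p * n.+1 ^ 2)).
  have dR := @derives_inverse K[i] f n p p0.
  by apply: solvable_of_derives dR => -[i j]; exact: mem_entries.
move=> /(_ _ (fun e => input_value (coeffs e) (genG e) (genB e) (nodes e))) [].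
  by move=> _ [v _ <-]; exists v.
move=> t tP; exists t => r Q tau a G B x R sQ dQ fQ x0 dR uR.
have [|out [k [rE kc oE]]] := tP (Problem r G B x (WQ n.+1 tau a) R).
  by split => //; apply: WQ_realizes sQ dQ fQ.
by exists out, k; split => // i j; rewrite oE.
Qed.
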